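(* Let $H$ be a separable infinite-dimensional complex Hilbert space, let $\widetilde J\colon H\to H$ be an anti-conjugation, and let $$\mathfrak{sp}_\infty(H)=\{X\in K(H)\mid X=-\widetilde J X^*\widetilde J^{-1}\}.$$ If $T=T^*\in\mathfrak{sp}_\infty(H)$, then there exists $Y\in\mathfrak{sp}_\infty(H)$ such that $T=[Y^*,Y]$.
   Context: $K(H)$ denotes the ideal of compact operators on $H$, $X^*$ is the Hilbert space adjoint, and $[X,Y]=XY-YX$. An anti-conjugation on $H$ is a conjugate-linear isometry $\widetilde J\colon H\to H$ (additive, norm-preserving, with $\widetilde J(\alpha v)=\bar\alpha\widetilde Jv$ for all $\alpha\in\mathbb C$, $v\in H$) satisfying $\widetilde J^2=-\mathbf 1$. *)

(* Defs.v *)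
From HB Require Import structures.
From mathcomp Require Import all_boot all_order all_algebra.
From mathcomp Require Import all_classical all_reals all_analysis.
From mathcomp Require Import complex.

Set Implicit Arguments.
Unset Strict Implicit.
Unset Printing Implicit Defensive.

Import Order.TTheory GRing.Theory Num.Theory.
Import numFieldNormedType.Exports.

Local Open Scope classical_set_scope.
Local Open Scope complex_scope.
Local Open Scope ring_scope.

(* A complex Hilbert space is a [completeNormedModType R[i]] with a positive
   definite Hermitian form [dot : {dot H for conjc}] inducing its norm.
   [dot] is linear in its first argument and conjugate-linear in its second. *)

Definition induces_norm (R : realType) (H : completeNormedModType R[i])
    (dot : {dot H for (@conjc R)}) : Prop :=
  forall v : H, `|v| ^+ 2 = dot v v.

Definition separable (T : topologicalType) : Prop :=
  exists2 D : set T, countable D & dense D.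

Definition infinite_dimensional (K : fieldType) (V : lmodType K) : Prop :=
  ~ exists (n : nat) (b : 'I_n -> V),
      forall v : V, exists c : 'I_n -> K, v = \sum_(i < n) c i *: b i.

(* Boundedness need not be required: it follows from compactness. *)
Definition compact_operator (R : realType) (H : completeNormedModType R[i])
    (X : {linear H -> H}) : Prop :=
  precompact (X @` [set v : H | `|v| <= 1]).

(* The value at [v] is the unique [w] with <X u, v> = <u, w> for all [u]. For
   bounded [X] it exists by the Riesz representation theorem; the default value
   [0] is only used for operators having no such [w]. *)
Definition adjoint (R : realType) (H : completeNormedModType R[i])
    (dot : {dot H for (@conjc R)}) (X : H -> H) : H -> H :=
  fun v => xget 0 [set w : H | forall u : H, dot (X u) v = dot u w].

Definition commutator (V : zmodType) (X Y : V -> V) : V -> V :=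
  fun v => X (Y v) - Y (X v).

Definition anti_conjugation (R : realType) (H : completeNormedModType R[i])
    (J : H -> H) : Prop :=
  [/\ forall u v : H, J (u + v) = J u + J v,
      forall (a : R[i]) (v : H), J (a *: v) = conjc a *: J v,
      forall v : H, `|J v| = `|v|
    & forall v : H, J (J v) = - v].

(* [pinv setT J] is the inverse of the (bijective) map [J]. *)
Definition sp_infty (R : realType) (H : completeNormedModType R[i])
    (dot : {dot H for (@conjc R)}) (J : H -> H) : set {linear H -> H} :=
  [set X | compact_operator X /\
           forall v : H, X v = - J (adjoint dot X (pinv setT J v))].

(* Main.v *)
(* A compact self-adjoint [T] with [T J = - J T] has spectrum symmetric about
   [0]: [J] maps the [l]-eigenspace to the orthogonal [-l]-eigenspace. Picking at
   each stage a maximiser of [|T v|] on the orthogonal complement of the vectors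
   found so far gives orthonormal [e_k] and [l_k >= 0] decreasing to [0] with
   [T = sum_k l_k (<., e_k> e_k - <., J e_k> J e_k)]. The operator
   [Y = sum_k sqrt(l_k) <., e_k> J e_k] satisfies [Y* = J Y J] (that is, [Y] has
   the symmetry of [sp]), [Y Y = 0] and [Y* Y - Y Y* = T].
   Compactness of [Y]: [|Y v|^2 = <v, Y* Y v>] and, as [Y* Y v] and [Y Y* v] are
   orthogonal, [|Y* Y v| <= |T v|]; so [|Y v|^2 <= |T v| |v|]. *)
Require Import Defs.
From HB Require Import structures.
From mathcomp Require Import all_boot all_order all_algebra.
From mathcomp Require Import all_classical all_reals all_analysis.
From mathcomp Require Import complex ring lra.

Set Implicit Arguments.
Unset Strict Implicit.
Unset Printing Implicit Defensive.

Import Order.TTheory GRing.Theory Num.Theory.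
Import numFieldNormedType.Exports.

Local Open Scope classical_set_scope.
Local Open Scope complex_scope.
Local Open Scope ring_scope.

(** * Total boundedness in terms of the real-valued norm *)

Section HilbertSpace.
Context (R : realType) (H : completeNormedModType R[i]).

(** The norm of [H] takes values in [R[i]]; its real part lets [lra] and [nra] work over the ordered
    field [R]. *)
Definition vnorm (v : H) : R := complex.Re `|v|.

Lemma vnormE v : `|v| = (vnorm v)%:C.
Proof. by rewrite /vnorm RRe_real // normr_real. Qed.

Lemma vnorm_ge0 v : 0 <= vnorm v.
Proof. by rewrite -ler0c -vnormE. Qed.

Lemma vnorm0 : vnorm 0 = 0.
Proof. by rewrite /vnorm normr0. Qed.

Lemma vnorm_eq0 v : vnorm v = 0 -> v = 0.
Proof. by move=> v0; apply/eqP; rewrite -normr_eq0 vnormE v0. Qed.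

Lemma vnormN v : vnorm (- v) = vnorm v.
Proof. by rewrite /vnorm normrN. Qed.

Lemma vnormD u v : vnorm (u + v) <= vnorm u + vnorm v.
Proof. by rewrite -lecR rmorphD /= -!vnormE ler_normD. Qed.

Lemma vnormB u v : vnorm (u - v) = vnorm (v - u).
Proof. by rewrite -vnormN opprB. Qed.

Lemma vnorm_triangle w u v : vnorm (u - v) <= vnorm (u - w) + vnorm (w - v).
Proof. by rewrite (_ : u - v = (u - w) + (w - v)) ?vnormD // addrA subrK. Qed.

Lemma vnormZ a v : vnorm (a *: v) = complex.Re `|a| * vnorm v.
Proof.
by rewrite /vnorm normrZ normc_def; case: `|v| => x y /=; rewrite mul0r subr0.
Qed.

Lemma vnormZr (a : R) v : 0 <= a -> vnorm (a%:C *: v) = a * vnorm v.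
Proof.
move=> a0; apply: complexI; rewrite rmorphM /= -!vnormE normrZ ger0_norm //.
by rewrite ler0c.
Qed.

Lemma vnorm_le1 v : (`|v| <= 1) = (vnorm v <= 1).
Proof. by rewrite vnormE -lecR. Qed.

Lemma vnorm_lipschitz u v : `|vnorm u - vnorm v| <= vnorm (u - v).
Proof.
have D x y : vnorm x <= vnorm (x - y) + vnorm y.
  by rewrite -{1}(subrK y x) vnormD.
rewrite ler_norml; move: (D u v) (D v u); rewrite (vnormB v u) => *.
by apply/andP; split; lra.
Qed.

Lemma ball_vnorm (x : H) (e : R) : ball x e%:C = [set y | vnorm (x - y) < e].
Proof.
rewrite -ball_normE /ball_; apply/seteqP.
by split=> y /=; rewrite vnormE ltcR.
Qed.

Lemma pos_complexP (e : R[i]) : 0 < e -> exists2 r : R, 0 < r & e = r%:C.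
Proof.
move=> e0; exists (complex.Re e); last by rewrite RRe_real // gtr0_real.
by move: e0; rewrite ltcE => /andP[].
Qed.

Lemma closure_vnormP (A : set H) x (e : R) :
  closure A x -> 0 < e -> exists2 y, A y & vnorm (x - y) < e.
Proof.
move=> cAx e0; have [|y []] := cAx (ball x e%:C).
  by apply: nbhsx_ballx; rewrite ltcR.
by rewrite ball_vnorm => Ay /= ye; exists y.
Qed.

Lemma closed_vnormP (A : set H) :
  (forall x, (forall e : R, 0 < e -> exists2 y, A y & vnorm (x - y) < e) -> A x) ->
  closed A.
Proof. by move=> cA x clx; apply: cA => e; exact: closure_vnormP. Qed.

Lemma cvg_of_rate (u : nat -> H) (b : nat -> R) :
  (forall k N, (k <= N)%N -> vnorm (u N - u k) <= b k) ->
  (forall e, 0 < e -> exists k, b k < e) ->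
  exists l, forall k, vnorm (l - u k) <= b k.
Proof.
move=> ub b0.
have : cauchy (u @ \oo).
  apply: cauchy_exP => _ /pos_complexP[e e0 ->].
  have [k bk] := b0 _ e0; exists (u k).
  rewrite ball_vnorm; exists k => // N /= kN.
  by rewrite vnormB (le_lt_trans (ub _ _ kN)).
move/cauchy_cvg/cvg_ex => [l ul]; exists l => k.
apply/ler_addgt0Pr => e e0.
have /ul : nbhs l (ball l e%:C) by apply: nbhsx_ballx; rewrite ltcR.
rewrite ball_vnorm => -[N _ /(_ (maxn N k))] /= /(_ (leq_maxl _ _)) le.
rewrite [b k + e]addrC (le_trans (vnorm_triangle (u (maxn N k)) _ _)) //.
by apply: lerD; [exact: ltW | exact: ub (leq_maxr _ _)].
Qed.

(** An ultrafilter containing a finite union of [e]-balls contains one of them, so it is Cauchy and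
    converges by completeness. *)
Lemma totally_bounded_precompact (A : set H) :
  (forall e : R, 0 < e -> exists s : seq H,
     forall x, A x -> exists2 p, p \in s & vnorm (p - x) < e) ->
  precompact A.
Proof.
move=> tbA; rewrite precompactE compact_ultra => F UF FA.
have : cauchy F.
  apply: cauchy_exP => _ /pos_complexP[e e0 ->].
  have e20 : 0 < e / 2 by lra.
  have [s sA] := tbA _ e20.
  have : F [set x | exists2 p, p \in s & ball p e%:C x].
    apply: filterS FA => x /closure_vnormP -/(_ _ e20) [y Ay xy].
    have [p ps py] := sA _ Ay; exists p => //.
    rewrite ball_vnorm /= (le_lt_trans (vnorm_triangle y _ _)) //.
    by rewrite (vnormB y x); lra.
  elim: s {sA} => [|p s IHs] Fs.
    by have [x []] := filter_ex Fs.
  have [Fp|Fnp] := in_ultra_setVsetC (ball p e%:C) UF; first by exists p.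
  apply: IHs; apply: filterS2 Fs Fnp => x [q].
  by rewrite inE => /orP[/eqP->|qs] qx //; exists q.
move/cauchy_cvg/cvg_ex => [l Fl]; exists l; split => //.
apply: closed_closure => B Bl.
by have FB : F B := Fl _ Bl; have [y] := filter_ex (filterI FA FB); exists y.
Qed.

Lemma precompact_totally_bounded (A : set H) (e : R) :
  precompact A -> 0 < e -> exists s : seq H,
    forall x, A x -> exists2 p, p \in s & vnorm (p - x) < e.
Proof.
rewrite precompactE compact_cover => cA e0.
have op (p : H) : setT p -> open (ball p e%:C)^° by move=> _; exact: open_interior.
have [x _|s _ sA] := cA H setT _ op.
  by exists x => //; apply: nbhsx_ballx; rewrite ltcR.
exists (finmap.enum_fset s) => x Ax.
have [p ps /interior_subset] := sA _ (subset_closure Ax).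
by rewrite ball_vnorm; exists p.
Qed.

Lemma vnorm_continuous : continuous (vnorm : H -> R).
Proof.
move=> x; apply/(@cvgrPdist_lt R R^o) => e e0.
have : nbhs x (ball x e%:C) by apply: nbhsx_ballx; rewrite ltcR.
rewrite ball_vnorm; apply: filterS => y /=.
by apply: le_lt_trans; exact: vnorm_lipschitz.
Qed.

End HilbertSpace.

Lemma le0_of_rate (R : realFieldType) (x K : R) :
  0 <= K -> (forall e, 0 < e -> x <= e * K) -> x <= 0.
Proof.
move=> K0 xe; rewrite leNgt; apply/negP => x0.
have K1 : 0 < K + 1 by lra.
(* Taken for [e], this value keeps [e * K] below [x / 2]; dividing by [K + 1] covers [K = 0]. *)
have e0 : 0 < x / (K + 1) / 2 by rewrite !divr_gt0.
have := xe _ e0; have xK : x / (K + 1) * (K + 1) = x by rewrite divfK // gt_eqF.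
nra.
Qed.

(** * Inner product and anti-conjugation *)

Section InnerProduct.
Context (R : realType) (H : completeNormedModType R[i]).
Context (dot : {dot H for (@conjc R)}) (hdot : induces_norm dot).

Lemma dotDl u v w : dot (u + v) w = dot u w + dot v w.
Proof. exact: linearDl. Qed.
Lemma dotDr w u v : dot w (u + v) = dot w u + dot w v.
Proof. exact: linearDr. Qed.
Lemma dotNl u w : dot (- u) w = - dot u w.
Proof. exact: linearNl. Qed.
Lemma dotNr w u : dot w (- u) = - dot w u.
Proof. exact: linearNr. Qed.
Lemma dotZl a u w : dot (a *: u) w = a * dot u w.
Proof. exact: linearZl_LR. Qed.
Lemma dotZr a w u : dot w (a *: u) = a^* * dot w u.
Proof. exact: linearZr_LR. Qed.
Lemma dotZr_conj a w u : dot w (a^* *: u) = a * dot w u.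
Proof. by rewrite dotZr; congr (_ * _); exact: conjcK. Qed.
Lemma dotZr_real (a : R) w u : dot w (a%:C *: u) = a%:C * dot w u.
Proof. by rewrite dotZr; congr (_ * _); exact: conjc_real. Qed.
Lemma dot0l w : dot 0 w = 0.
Proof. exact: linear0l. Qed.
Lemma dot0r w : dot w 0 = 0.
Proof. exact: linear0r. Qed.

Lemma dotC u v : dot u v = (dot v u)^*.
Proof. by rewrite (hermC dot) expr0 mul1r. Qed.

Lemma dotvv v : dot v v = (vnorm v ^+ 2)%:C.
Proof. by rewrite -hdot vnormE rmorphXn. Qed.

Definition rdot (u v : H) : R := complex.Re (dot u v).

Lemma rdotC u v : rdot u v = rdot v u.
Proof. by rewrite /rdot dotC; case: (dot v u). Qed.
Lemma rdotDl u v w : rdot (u + v) w = rdot u w + rdot v w.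
Proof. by rewrite /rdot dotDl raddfD. Qed.
Lemma rdotDr u v w : rdot w (u + v) = rdot w u + rdot w v.
Proof. by rewrite /rdot dotDr raddfD. Qed.
Lemma rdotNl u w : rdot (- u) w = - rdot u w.
Proof. by rewrite /rdot dotNl raddfN. Qed.
Lemma rdotNr u w : rdot w (- u) = - rdot w u.
Proof. by rewrite /rdot dotNr raddfN. Qed.
Lemma rdotZl (a : R) u w : rdot (a%:C *: u) w = a * rdot u w.
Proof. by rewrite /rdot dotZl; case: (dot u w) => x y /=; rewrite mul0r subr0. Qed.
Lemma rdotZr (a : R) u w : rdot w (a%:C *: u) = a * rdot w u.
Proof. by rewrite rdotC rdotZl rdotC. Qed.
Lemma rdotvv v : rdot v v = vnorm v ^+ 2.
Proof. by rewrite /rdot dotvv. Qed.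
Definition rdotE := (rdotDl, rdotDr, rdotNl, rdotNr, rdotZl, rdotZr).

Lemma vnormD_sq u v : vnorm (u + v) ^+ 2 = vnorm u ^+ 2 + vnorm v ^+ 2 + 2 * rdot u v.
Proof. by rewrite -!rdotvv !rdotE (rdotC v u); ring. Qed.

Lemma vnormB_sq u v : vnorm (u - v) ^+ 2 = vnorm u ^+ 2 + vnorm v ^+ 2 - 2 * rdot u v.
Proof. by rewrite vnormD_sq vnormN rdotNr; ring. Qed.

(** Cauchy-Schwarz is read off from the triangle inequality by expanding the square of
    [vnorm (u + v)]. *)
Lemma rdot_le u v : rdot u v <= vnorm u * vnorm v.
Proof.
have := vnormD_sq u v; have := vnormD u v.
have := vnorm_ge0 u; have := vnorm_ge0 v; have := vnorm_ge0 (u + v).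
nra.
Qed.

Lemma rdot_eq_dot u v u' v' :
  (forall a : R[i], rdot (a *: u) v = rdot (a *: u') v') -> dot u v = dot u' v'.
Proof.
move=> e; move: (e 1) (e 'i%C); rewrite /rdot !dotZl !mul1r.
case: (dot u v) (dot u' v') => [x y] [x' y'] /= -> .
by rewrite !mul0r !mul1r !sub0r => /oppr_inj ->.
Qed.

(** Continuity of [dot] in quantitative form: pairing [w] with [dot w e *: e] gives the squared
    modulus of [dot w e], which is then at most [eps * K] for every [eps]. *)
Lemma dot_closure w e :
  (forall eps : R, 0 < eps -> exists2 y, dot y e = 0 & vnorm (w - y) < eps) ->
  dot w e = 0.
Proof.
move=> cl; have : rdot w (dot w e *: e) <= 0.
  apply: (@le0_of_rate _ _ (vnorm (dot w e *: e))) => [|eps eps0].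
    exact: vnorm_ge0.
  have [y ye wy] := cl _ eps0.
  have -> : rdot w (dot w e *: e) = rdot (w - y) (dot w e *: e).
    by rewrite rdotDl rdotNl /(rdot y) dotZr ye mulr0 subr0.
  apply: le_trans (rdot_le _ _) _.
  by rewrite ler_wpM2r ?vnorm_ge0 ?ltW.
rewrite /rdot dotZr; case: (dot w e) => x y /=.
rewrite mulNr opprK => xy.
have x0 : x = 0 by nra.
by rewrite x0; have -> : y = 0 by nra.
Qed.

Section AntiConjugation.
Context (J : H -> H) (hJ : anti_conjugation J).

Lemma anticonjD u v : J (u + v) = J u + J v. Proof. by case: hJ. Qed.
Lemma anticonjZ a v : J (a *: v) = a^* *: J v. Proof. by case: hJ. Qed.
Lemma anticonjZr (a : R) v : J (a%:C *: v) = a%:C *: J v.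
Proof. by rewrite anticonjZ; congr (_ *: _); exact: conjc_real. Qed.
Lemma anticonjZ_conj a v : J (a^* *: v) = a *: J v.
Proof. by rewrite anticonjZ; congr (_ *: _); exact: conjcK. Qed.
Lemma anticonjK v : J (J v) = - v. Proof. by case: hJ. Qed.
Lemma anticonj0 : J 0 = 0.
Proof. by apply: (addrI (J 0)); rewrite -anticonjD !addr0. Qed.
Lemma anticonjN v : J (- v) = - J v.
Proof. by apply: (addrI (J v)); rewrite -anticonjD !subrr anticonj0. Qed.
Lemma vnormJ v : vnorm (J v) = vnorm v.
Proof. by case: hJ => _ _ Jn _; rewrite /vnorm Jn. Qed.

Lemma vnormZJ a v : vnorm (a *: J v) = vnorm (a *: v).
Proof. by case: hJ => _ _ Jn _; rewrite /vnorm !normrZ Jn. Qed.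

Lemma rdotJJ u v : rdot (J u) (J v) = rdot u v.
Proof.
by have := vnormD_sq (J u) (J v); rewrite -anticonjD !vnormJ vnormD_sq; lra.
Qed.

(** Polarisation has settled the real parts; testing on [i u] gives the imaginary parts with
    reversed sign, since [J] is conjugate-linear. *)
Lemma dotJJ u v : dot (J u) (J v) = dot v u.
Proof.
rewrite [RHS]dotC; have := rdotJJ ('i%C *: u) v; have := rdotJJ u v.
rewrite anticonjZ /rdot !dotZl; case: (dot (J u) _) (dot u v) => [x y] [x' y'] /= ->.
by rewrite !mul0r !sub0r !mul1r !mulN1r !opprK => ->.
Qed.

Lemma dotJl u v : dot (J u) v = - dot (J v) u.
Proof. by rewrite -(dotJJ u (J v)) anticonjK dotNr opprK. Qed.

Lemma dotJr u v : dot u (J v) = - dot v (J u).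
Proof. by rewrite -(dotJJ (J v) u) anticonjK dotNl. Qed.

(** As [J] squares to [-1], the form [dot (J u) v] is antisymmetric, hence zero on the diagonal.
    This makes [e] and [J e] orthogonal. *)
Lemma dotJvv v : dot (J v) v = 0.
Proof.
have /eqP := dotJl v v; rewrite -addr_eq0 -mulr2n mulrn_eq0 /=.
by move/eqP.
Qed.

Lemma pinvJ v : pinv setT J v = - J v.
Proof.
have Ji : {in setT &, injective J}.
  by move=> x y _ _ e; apply: oppr_inj; rewrite -!anticonjK e.
apply: Ji; rewrite ?inE // anticonjN anticonjK opprK pinvK // inE.
by exists (- J v); rewrite // anticonjN anticonjK opprK.
Qed.

End AntiConjugation.
End InnerProduct.

(** * The dominant eigenvector *)

Section Operators.
Context (R : realType) (H : completeNormedModType R[i]).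
Context (dot : {dot H for (@conjc R)}) (hdot : induces_norm dot).

(** The difference of two candidates is orthogonal to every vector, so it vanishes; adjoints can
    thus be computed by exhibiting one candidate. *)
Lemma adjoint_unique (X : H -> H) v w :
  (forall u, dot (X u) v = dot u w) -> adjoint dot X v = w.
Proof.
move=> wP; apply: xget_unique => // y yP.
have yw : dot (y - w) (y - w) = 0.
  by rewrite [LHS]dotDr dotNr -yP -wP subrr.
apply/eqP; rewrite -subr_eq0; apply/eqP/vnorm_eq0.
by move: yw; rewrite (dotvv hdot) => /complexI /eqP; rewrite sqrf_eq0 => /eqP.
Qed.

(* Where no adjoint vector exists, [adjoint] takes the junk value [0]; the
   vectors having one form a subspace, so [T =1 adjoint dot T] excludes this. *)
Lemma selfadjoint_dot (T : {linear H -> H}) :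
  T =1 adjoint dot T -> forall u v, dot (T u) v = dot u (T v).
Proof.
move=> Tsa.
have [dom|] := pselect (forall v, exists w, forall u, dot (T u) v = dot u w).
  move=> u v; have [w wP] := dom v.
  by rewrite (Tsa v) (adjoint_unique wP).
move/existsNP => [v vN].
have T0 x : ~ (exists w, forall u, dot (T u) x = dot u w) -> T x = 0.
  move=> xN; rewrite Tsa /adjoint xgetPN // => w /= xw; apply: xN.
  by exists w.
have T00 x : T x = 0.
  have [[w wP]|] := pselect (exists w, forall u, dot (T u) x = dot u w); last exact: T0.
  have : T (v + x) = 0.
    apply: T0 => -[w' w'P]; apply: vN; exists (w' - w) => u.
    by rewrite dotDr dotNr -w'P -wP dotDr addrK.
  by rewrite raddfD /= (T0 v vN) add0r.
by move=> u w; rewrite !T00 dot0l dot0r.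
Qed.

Lemma linear_bound (T : {linear H -> H}) (M : set H) (C : R) :
  (forall a v, M v -> M (a *: v)) ->
  (forall v, M v -> vnorm v <= 1 -> vnorm (T v) <= C) ->
  forall v, M v -> vnorm (T v) <= C * vnorm v.
Proof.
move=> MZ TC v Mv; have [v0|v0] := eqVneq (vnorm v) 0.
  by rewrite (vnorm_eq0 v0) raddf0 vnorm0 mulr0.
have v_gt0 : 0 < vnorm v by rewrite lt_neqAle eq_sym v0 vnorm_ge0.
have := TC _ (MZ (vnorm v)^-1%:C _ Mv).
rewrite linearZ /= !vnormZr ?invr_ge0 ?vnorm_ge0 // mulVf // => /(_ (lexx _)).
by rewrite mulrC ler_pdivrMr.
Qed.

Section Eigenvector.
Context (J : H -> H) (hJ : anti_conjugation J).
Context (T : {linear H -> H}) (hT : compact_operator T).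
Context (Tsym : forall u v, dot (T u) v = dot u (T v)).
Context (TJ : forall v, T (J v) = - J (T v)).

(** One stage of the greedy choice: [M] will be the orthogonal complement of the vectors found so
    far. Since [T] anticommutes with [J], [l] can be taken nonnegative; the zero vector is returned
    when [T] vanishes on [M]. *)
Lemma dominant_eigenvector (M : set H) :
  (forall u v, M u -> M v -> M (u + v)) -> (forall a v, M v -> M (a *: v)) ->
  closed M -> M 0 ->
  (forall v, M v -> M (T v)) -> (forall v, M v -> M (J v)) ->
  exists l e, [/\ 0 <= l, M e, T e = l%:C *: e,
    vnorm e = 1 \/ (e = 0 /\ l = 0) & forall v, M v -> vnorm (T v) <= l * vnorm v].
Proof.
move=> MD MZ Mcl M0 MT MJ.
pose B := [set v | M v /\ vnorm v <= 1].
have cK : compact (closure (T @` B)).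
  rewrite -precompactE; apply: precompact_subset hT => _ [v [_ v1] <-].
  by exists v; rewrite //= vnorm_le1.
have TB v : B v -> closure (T @` B) (T v).
  by move=> Bv; apply: subset_closure; exists v.
(* [w] is a limit of [T v] with [v] nearly maximising, and a maximiser [v]
   satisfies [T (T v) = l^2 v]; hence [(T - l) (T + l) w = 0]. *)
have [||w /set_mem Kw wmax] := @compact_EVT_max _ _ (@vnorm R H) _ _ cK.
- by exists (T 0); apply: TB; split; rewrite ?vnorm0.
- by apply: continuous_subspaceT; exact: vnorm_continuous.
set l := vnorm w.
have l0 : 0 <= l := vnorm_ge0 w.
have Tl v : M v -> vnorm (T v) <= l * vnorm v.
  apply: linear_bound => // {}v Mv v1.
  by apply: wmax; rewrite inE; apply: TB.
have Mw : M w.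
  apply: Mcl; apply: closureS Kw => _ [v [Mv _] <-]; exact: MT.
pose z x := T (T x) - (l ^+ 2)%:C *: x.
have MN v : M v -> M (- v) by rewrite -scaleN1r; exact: MZ.
have zM x : M x -> M (z x).
  by move=> Mx; apply: MD; [apply/MT/MT | apply/MN/MZ].
have zD x y : z (x + y) = z x + z y.
  by rewrite /z (linearD T) (linearD T) scalerDr opprD addrACA.
(* Expand the square and use [<T T x, x> = |T x|^2] and [|T T x| <= l |T x|]. *)
have z_sq x :
  M x -> vnorm (z x) ^+ 2 <= l ^+ 4 * vnorm x ^+ 2 - l ^+ 2 * vnorm (T x) ^+ 2.
  move=> Mx; rewrite (vnormB_sq hdot) vnormZr ?sqr_ge0 // rdotZr.
  have -> : rdot dot (T (T x)) x = vnorm (T x) ^+ 2.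
    by rewrite /rdot Tsym -/(rdot dot _ _) (rdotvv hdot).
  have := Tl _ (MT _ Mx); move: (vnorm_ge0 (T x)) (vnorm_ge0 (T (T x))).
  move: (vnorm (T x)) (vnorm (T (T x))) (vnorm x) => a b c a0 b0 ba.
  have : b ^+ 2 <= (l * a) ^+ 2 by rewrite lerXn2r ?nnegrE ?mulr_ge0.
  by rewrite !exprMn; lra.
have zw0 : vnorm (z w) ^+ 2 <= 0.
  (* The two summands of [z w] will give at most [8 eps l^5] in total; the constant 20 leaves
     room. *)
  apply: (@le0_of_rate _ _ (20 * l ^+ 5)) => [|eps eps0].
    by rewrite mulr_ge0 ?exprn_ge0.
  have [_ [v [Mv v1] <-] wv] := closure_vnormP Kw eps0.
  have Md : M (w - T v) by apply: MD => //; apply/MN/MT.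
  have Tvl : l - eps <= vnorm (T v).
    by have := vnormD (w - T v) (T v); rewrite subrK -/l; lra.
  have Tvl' : vnorm (T v) <= l.
    by apply: le_trans (Tl _ Mv) _; rewrite ler_piMr.
  have -> : z w = z (w - T v) + T (z v).
    rewrite (_ : T (z v) = z (T v)); last by rewrite /z raddfB /= linearZ.
    by rewrite -zD subrK.
  have h1 := z_sq _ Md.
  have h2 := z_sq _ Mv.
  have h3 := Tl _ (zM _ Mv).
  (* Both summands have squared norm at most [2 eps l^5]; then use
     [|a + b|^2 <= 2 |a|^2 + 2 |b|^2]. *)
  have := vnormD_sq hdot (z (w - T v)) (T (z v)).
  have := vnormB_sq hdot (z (w - T v)) (T (z v)).
  have := sqr_ge0 (vnorm (z (w - T v) - T (z v))).
  have d1 : vnorm (w - T v) <= l + l.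
    by apply: le_trans (vnormD _ _) _; rewrite vnormN lerD.
  have d2 : vnorm (w - T v) ^+ 2 <= 2 * l * eps.
    have := vnorm_ge0 (w - T v); nra.
  have d3 : l ^+ 2 - vnorm (T v) ^+ 2 <= 2 * l * eps.
    have := vnorm_ge0 (T v); nra.
  have d4 : vnorm (T (z v)) ^+ 2 <= l ^+ 2 * (l ^+ 2 * (2 * l * eps)).
    have : vnorm (T (z v)) ^+ 2 <= (l * vnorm (z v)) ^+ 2.
      by rewrite lerXn2r ?nnegrE ?mulr_ge0 ?vnorm_ge0.
    rewrite exprMn => /le_trans; apply; rewrite ler_wpM2l ?sqr_ge0 //.
    apply: (le_trans h2).
    have : l ^+ 4 * vnorm v ^+ 2 <= l ^+ 4.
      by rewrite ler_piMr ?exprn_ge0 // exprn_ile1 ?vnorm_ge0.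
    have : l ^+ 2 * (l ^+ 2 - vnorm (T v) ^+ 2) <= l ^+ 2 * (2 * l * eps).
      by rewrite ler_wpM2l ?sqr_ge0.
    by rewrite (_ : l ^+ 4 = l ^+ 2 * l ^+ 2); [lra | ring].
  have d5 : vnorm (z (w - T v)) ^+ 2 <= l ^+ 4 * (2 * l * eps).
    apply: (le_trans h1); rewrite lerBlDr.
    apply: le_trans (_ : l ^+ 4 * (2 * l * eps) <= _).
      by rewrite ler_wpM2l ?exprn_ge0.
    by rewrite lerDl mulr_ge0 ?sqr_ge0.
  have d6 : 0 <= eps * l ^+ 5 by rewrite mulr_ge0 ?exprn_ge0 // ltW.
  have e1 : l ^+ 4 * (2 * l * eps) = 2 * (eps * l ^+ 5) by ring.
  have e2 : l ^+ 2 * (l ^+ 2 * (2 * l * eps)) = 2 * (eps * l ^+ 5) by ring.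
  move: d4 d5; rewrite e1 e2 => *; lra.
have Tw : T (T w) = (l ^+ 2)%:C *: w.
  apply/eqP; rewrite -subr_eq0; apply/eqP/vnorm_eq0/eqP.
  by rewrite -sqrf_eq0 eq_le zw0 sqr_ge0.
suff [u [Mu u0 Tu]] : exists u, [/\ M u, l <> 0 -> u <> 0 & T u = l%:C *: u].
  have [l00|/eqP l_neq0] := eqVneq l 0.
    by exists l, 0; rewrite raddf0 scaler0; split => //; right.
  have u_neq0 : vnorm u != 0 by apply/eqP => /vnorm_eq0 /(u0 l_neq0).
  exists l, ((vnorm u)^-1%:C *: u); split => //.
  - exact: MZ.
  - by rewrite linearZ /= Tu !scalerA mulrC.
  - by left; rewrite vnormZr ?invr_ge0 ?vnorm_ge0 // mulVf.
(* By [Tw], [T - l] kills [(T + l) w]. Either this vector is nonzero and an eigenvector for [l], or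
   [T w = - l w] and [J w] is an eigenvector for [l]. *)
have [Tlw|/eqP Tlw] := eqVneq (T w + l%:C *: w) 0; last first.
  exists (T w + l%:C *: w); split => //.
    by apply: MD; [exact: MT | exact: MZ].
  by rewrite raddfD /= linearZ /= Tw scalerDr scalerA -rmorphM -expr2 addrC.
exists (J w); split; first exact: MJ.
  by move=> l_neq0 Jw0; apply: l_neq0; rewrite /l -(vnormJ hJ) Jw0 vnorm0.
move/eqP: Tlw; rewrite addr_eq0 => /eqP Tlw.
by rewrite TJ Tlw (anticonjN hJ) opprK (anticonjZr hJ).
Qed.

End Eigenvector.
End Operators.

(** * The spectral sequence *)

(** Dependent choice with full history: each eigenvector must be orthogonal to all earlier ones, not
    only to the last. *)
Lemma seq_choice (A : Type) (P : seq A -> A -> Prop) :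
  (forall s, exists a, P s a) -> exists c : nat -> A, forall k, P (mkseq c k) (c k).
Proof.
move=> /choice [f fP]; pose st k := iter k (fun s => rcons s (f s)) [::].
exists (fun k => f (st k)) => k; suff -> : mkseq (f \o st) k = st k by [].
by elim: k => // k IHk; rewrite mkseqS IHk.
Qed.

Section Spectral.
Context (R : realType) (H : completeNormedModType R[i]).
Context (dot : {dot H for (@conjc R)}) (hdot : induces_norm dot).
Context (J : H -> H) (hJ : anti_conjugation J).

(** Orthogonality to the complex span of [e] and [J e], the smallest [J]-stable subspace containing
    [e]; the complement is then [J]-stable too. *)
Definition J_orthogonal (v e : H) : Prop := dot v e = 0 /\ dot v (J e) = 0.

Lemma J_orthogonalJ v e : J_orthogonal v e -> J_orthogonal (J v) e.
Proof.
move=> [ve vJe]; split.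
  by rewrite (dotJl hdot hJ) dotC vJe rmorph0 oppr0.
by rewrite (dotJJ hdot hJ) dotC ve rmorph0.
Qed.

(* A zero vector [e k] is allowed where [l k = 0], so that an operator of finite
   rank also has an infinite spectral sequence. *)
Definition spectral_seq (T : H -> H) (l : nat -> R) (e : nat -> H) : Prop :=
  [/\ forall k, 0 <= l k, forall k, T (e k) = (l k)%:C *: e k,
      forall k, vnorm (e k) = 1 \/ (e k = 0 /\ l k = 0),
      forall j k, (j < k)%N -> J_orthogonal (e k) (e j) &
      forall k v, (forall j, (j < k)%N -> J_orthogonal v (e j)) ->
        vnorm (T v) <= l k * vnorm v].

Section Existence.
Context (T : {linear H -> H}) (hT : compact_operator T).
Context (Tsym : forall u v, dot (T u) v = dot u (T v)).
Context (TJ : forall v, T (J v) = - J (T v)).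

Lemma spectral_seq_exists : exists l e, spectral_seq T l e.
Proof.
pose M (s : seq (R * H)) := [set v | forall b, b \in s -> J_orthogonal v b.2].
(* [seq_choice] asks for an answer for every list, so [P] is conditional on the list consisting of
   eigenpairs; other lists get the dummy [(0, 0)]. *)
pose P s (a : R * H) := (forall b, b \in s -> T b.2 = b.1%:C *: b.2) ->
  [/\ 0 <= a.1, M s a.2, T a.2 = a.1%:C *: a.2,
    vnorm a.2 = 1 \/ (a.2 = 0 /\ a.1 = 0) &
    forall v, M s v -> vnorm (T v) <= a.1 * vnorm v].
have [s|c cP] := @seq_choice _ P.
  have [eig|] := pselect (forall b, b \in s -> T b.2 = b.1%:C *: b.2); last first.
    by move=> neig; exists (0, 0) => /neig.
  have [||||||l [e []]] := @dominant_eigenvector _ _ _ hdot J hJ T hT Tsym TJ (M s).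
  - move=> u v Mu Mv b bs; have [u1 u2] := Mu b bs; have [v1 v2] := Mv b bs.
    by split; rewrite dotDl ?u1 ?v1 ?u2 ?v2 addr0.
  - move=> a v Mv b bs; have [v1 v2] := Mv b bs.
    by split; rewrite dotZl ?v1 ?v2 mulr0.
  - apply: closed_vnormP => v vcl b bs.
    split; apply: (dot_closure hdot) => eps /vcl [y My vy]; exists y => //.
      by have [] := My b bs.
    by have [] := My b bs.
  - by move=> b bs; split; rewrite dot0l.
  - move=> v Mv b bs; have [v1 v2] := Mv b bs; split; rewrite Tsym.
      by rewrite (eig b bs) dotZr v1 mulr0.
    by rewrite TJ (eig b bs) (anticonjZr hJ) dotNr dotZr v2 mulr0 oppr0.
  - by move=> v Mv b bs; apply: J_orthogonalJ; exact: Mv.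
  by exists (l, e).
have eig k : T (c k).2 = (c k).1%:C *: (c k).2.
  elim/ltn_ind: k => k IHk; have [] // := cP k.
  by move=> _ /mapP[j + ->]; rewrite mem_iota => /andP[_ jk]; exact: IHk.
have {}cP k : P (mkseq c k) (c k) /\ forall b, b \in mkseq c k -> T b.2 = b.1%:C *: b.2.
  by split=> // _ /mapP[j _ ->].
exists (fst \o c), (snd \o c); split=> /= [k|k|k|j k jk|k v vk].
- by have [/[apply] -[]] := cP k.
- exact: eig.
- by have [/[apply] -[]] := cP k.
- have [/[apply] -[_ + _ _ _]] := cP k; apply.
  by apply: map_f; rewrite mem_iota.
- have [/[apply] -[_ _ _ _]] := cP k; apply.
  by move=> _ /mapP[j + ->]; rewrite mem_iota => /andP[_]; exact: vk.
Qed.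

End Existence.

(** * Decay of the eigenvalues *)

Section Limit.
Context (T : {linear H -> H}) (l : nat -> R) (e : nat -> H).
Context (sT : spectral_seq T l e).

(** The vector [e k] is already admissible at stage [j], so the bound of that stage applies to
    it. *)
Lemma spectral_seq_mono j k : (j <= k)%N -> l k <= l j.
Proof.
case: sT => l0 Te en ort Tl jk.
have [ek|[_ ->]] := en k; last exact: l0.
have := Tl j (e k); rewrite Te vnormZr // ek !mulr1; apply => i ij.
by apply: ort; apply: leq_trans ij jk.
Qed.

(** If every [l k] were at least [eps], the vectors [T (e k)] would be pairwise [eps]-separated,
    against compactness of [T]. *)
Lemma spectral_seq_cvg0 : compact_operator T ->
  forall eps, 0 < eps -> exists k, l k < eps.
Proof.
case: sT => l0 Te en ort Tl hT eps eps0.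
apply: contrapT => /forallNP lk.
have {}lk k : eps <= l k by rewrite leNgt; apply/negP/lk.
have ek k : vnorm (e k) = 1.
  by have [//|[_ lk0]] := en k; have := lk k; rewrite lk0 leNgt eps0.
have Tij i j : (i < j)%N -> eps <= vnorm (T (e j) - T (e i)).
  move=> ij; have := vnormB_sq hdot (T (e j)) (T (e i)).
  rewrite !Te !vnormZr // !ek !rdotE /rdot.
  have [-> _] := ort _ _ ij.
  have := lk i; have := lk j; have := vnorm_ge0 ((l j)%:C *: e j - (l i)%:C *: e i).
  rewrite /= => *; nra.
have cK : compact (closure (T @` [set v | `|v| <= 1])) by rewrite -precompactE.
pose F := (T \o e) @ \oo.
have FF : ProperFilter F by exact: fmap_proper_filter.
have [|p [_ Fp]] := cK F FF.
  exists 0%N => // k _ /=; apply: subset_closure; exists (e k) => //=.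
  by rewrite vnorm_le1 ek.
have e20 : 0 < eps / 2 by lra.
have near k : exists2 j, (k <= j)%N & vnorm (p - T (e j)) < eps / 2.
  pose tail := [set T (e j) | j in [set j | (k <= j)%N]].
  have [||_ [[j kj <-]]] := Fp tail (ball p (eps / 2)%:C).
  - by exists k => // j /= kj; exists j.
  - by apply: nbhsx_ballx; rewrite ltcR.
  by rewrite ball_vnorm => pj; exists j.
(* Starting the second search at [i.+1] forces [i < j]; both images lie within [eps / 2] of [p],
   against the separation. *)
have [i _ pi] := near 0%N; have [j ij pj] := near i.+1.
have := Tij _ _ ij; have := vnorm_triangle p (T (e j)) (T (e i)).
rewrite (vnormB (T (e j)) p); lra.
Qed.

End Limit.
End Spectral.

(** * The commutator root *)

Section Root.
Context (R : realType) (H : completeNormedModType R[i]).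
Context (dot : {dot H for (@conjc R)}) (hdot : induces_norm dot).
Context (J : H -> H) (hJ : anti_conjugation J).
Context (T : {linear H -> H}) (hT : compact_operator T).
Context (TJ : forall v, T (J v) = - J (T v)).
Context (l : nat -> R) (e : nat -> H) (sT : spectral_seq dot J T l e).

Lemma spectral_ge0 k : 0 <= l k. Proof. by case: sT. Qed.
Local Hint Resolve spectral_ge0 : core.
Lemma spectral_eigen k : T (e k) = (l k)%:C *: e k. Proof. by case: sT => _ ->. Qed.
Definition svalue k : R := Num.sqrt (l k).
Lemma svalue_ge0 k : 0 <= svalue k. Proof. exact: sqrtr_ge0. Qed.
Local Hint Resolve svalue_ge0 : core.
Lemma svalue_sq k : svalue k ^+ 2 = l k. Proof. by rewrite sqr_sqrtr. Qed.
Lemma svalue_mono j k : (j <= k)%N -> svalue k <= svalue j.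
Proof. by move=> jk; apply: ler_wsqrtr; exact: (spectral_seq_mono sT). Qed.

(** True for a unit vector and for the zero vector alike, so the projections can be computed without
    a case split. *)
Lemma spectral_dot_self i v : dot v (e i) * dot (e i) (e i) = dot v (e i).
Proof.
case: sT => _ _ /(_ i) [ei|[-> _]] _ _; last by rewrite dot0r mul0r.
by rewrite (dotvv hdot) ei expr1n mulr1.
Qed.

Lemma spectral_dotJ_self i v : dot v (J (e i)) * dot (e i) (e i) = dot v (J (e i)).
Proof.
case: sT => _ _ /(_ i) [ei|[-> _]] _ _; last by rewrite (anticonj0 hJ) dot0r mul0r.
by rewrite (dotvv hdot) ei expr1n mulr1.
Qed.

Lemma spectral_orth i j : i != j -> dot (e i) (e j) = 0.
Proof.
case: sT => _ _ _ ort _; rewrite neq_ltn => /orP[/ort[+ _]|/ort[]//].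
by move=> ji; rewrite dotC ji rmorph0.
Qed.

Lemma spectral_orthJ i j : dot (e i) (J (e j)) = 0.
Proof.
case: sT => _ _ _ ort _; case: (ltngtP i j) => [/ort[]|/ort[]|->] //.
  by move=> _ ji; rewrite (dotJr hdot hJ) ji oppr0.
by rewrite dotC (dotJvv hdot hJ) rmorph0.
Qed.

Lemma spectral_Jorth i j : dot (J (e i)) (e j) = 0.
Proof. by rewrite dotC spectral_orthJ rmorph0. Qed.

(** * Projections, residuals and partial sums of the root *)

Definition spectral_proj N v :=
  \sum_(i < N) (dot v (e i) *: e i + dot v (J (e i)) *: J (e i)).
Definition spectral_resid N v := v - spectral_proj N v.
Definition root_sum N v := \sum_(i < N) (svalue i)%:C *: (dot v (e i) *: J (e i)).

Lemma spectral_projS N v :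
  spectral_proj N.+1 v =
  spectral_proj N v + (dot v (e N) *: e N + dot v (J (e N)) *: J (e N)).
Proof. by rewrite /spectral_proj big_ord_recr. Qed.
Lemma spectral_residS N v :
  spectral_resid N.+1 v =
  spectral_resid N v - (dot v (e N) *: e N + dot v (J (e N)) *: J (e N)).
Proof. by rewrite /spectral_resid spectral_projS opprD addrA. Qed.
Lemma root_sumS N v :
  root_sum N.+1 v = root_sum N v + (svalue N)%:C *: (dot v (e N) *: J (e N)).
Proof. by rewrite /root_sum big_ord_recr. Qed.

Lemma spectral_proj_orth k N v :
  (N <= k)%N -> J_orthogonal dot J (spectral_proj N v) (e k).
Proof.
elim: N => [|N IHN] Nk; first by rewrite /spectral_proj big_ord0; split; rewrite dot0l.
have [P1 P2] := IHN (ltnW Nk).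
have Nk' : k != N by rewrite gtn_eqF.
split; rewrite spectral_projS !dotDl !dotZl ?P1 ?P2 ?spectral_orthJ ?spectral_Jorth
  ?(dotJJ hdot hJ) spectral_orth ?mulr0 ?addr0 //.
by rewrite eq_sym.
Qed.

Lemma spectral_resid_orth j N v :
  (j < N)%N -> J_orthogonal dot J (spectral_resid N v) (e j).
Proof.
elim: N => // N IHN; rewrite ltnS leq_eqVlt => /orP[/eqP->{j IHN}|jN].
  have [P1 P2] := spectral_proj_orth v (leqnn N).
  split; rewrite /spectral_resid dotDl dotNl spectral_projS !dotDl !dotZl ?P1 ?P2
    ?spectral_orthJ ?spectral_Jorth ?(dotJJ hdot hJ).
    by rewrite mulr0 add0r addr0 spectral_dot_self subrr.
  by rewrite mulr0 !add0r spectral_dotJ_self subrr.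
have [r1 r2] := IHN jN.
have jN' : N != j by rewrite gtn_eqF.
split; rewrite spectral_residS dotDl ?r1 ?r2 dotNl dotDl !dotZl ?spectral_orthJ
  ?spectral_Jorth ?(dotJJ hdot hJ) spectral_orth ?mulr0 ?addr0 ?subr0 //.
by rewrite eq_sym.
Qed.

(** Pythagoras. The [J (e N)] component is dropped, because only the [e N] component enters
    [root_sum]. *)
Lemma spectral_resid_step N v :
  vnorm (spectral_resid N.+1 v) ^+ 2 + vnorm (dot v (e N) *: e N) ^+ 2
  <= vnorm (spectral_resid N v) ^+ 2.
Proof.
set q := dot v (e N) *: e N; set q' := dot v (J (e N)) *: J (e N).
have -> : spectral_resid N v = spectral_resid N.+1 v + (q + q').
  by rewrite spectral_residS subrK.
rewrite (vnormD_sq hdot _ (q + q')) (vnormD_sq hdot q).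
have [r1 r2] := spectral_resid_orth v (ltnSn N).
have -> : rdot dot (spectral_resid N.+1 v) (q + q') = 0.
  by rewrite /rdot dotDr /q /q' !dotZr r1 r2 !mulr0 addr0.
have -> : rdot dot q q' = 0.
  by rewrite /rdot /q /q' dotZl dotZr spectral_orthJ !mulr0.
by have := sqr_ge0 (vnorm q'); lra.
Qed.

Lemma spectral_resid_le N v : vnorm (spectral_resid N v) <= vnorm v.
Proof.
rewrite -(@ler_sqr _ (vnorm _)) ?nnegrE ?vnorm_ge0 //.
elim: N => [|N]; first by rewrite /spectral_resid /spectral_proj big_ord0 subr0.
apply: le_trans; have := spectral_resid_step N v.
by have := sqr_ge0 (vnorm (dot v (e N) *: e N)); lra.
Qed.

Lemma root_sum_orth k N v : (N <= k)%N -> dot (root_sum N v) (J (e k)) = 0.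
Proof.
elim: N => [|N IHN] Nk; first by rewrite /root_sum big_ord0 dot0l.
by rewrite root_sumS dotDl IHN ?(ltnW Nk) // !dotZl (dotJJ hdot hJ) spectral_orth
  ?mulr0 ?addr0 // gtn_eqF.
Qed.

(* Bessel's inequality with weights: each new term of the left hand side is
   paid for by the decrease of the residual. *)
Lemma root_sum_dist_sq k N v : (k <= N)%N ->
  vnorm (root_sum N v - root_sum k v) ^+ 2 + l k * vnorm (spectral_resid N v) ^+ 2
  <= l k * vnorm (spectral_resid k v) ^+ 2.
Proof.
elim: N => [|N IHN].
  by rewrite leqn0 => /eqP->; rewrite subrr vnorm0 expr0n add0r.
rewrite leq_eqVlt => /orP[/eqP->|]; first by rewrite subrr vnorm0 expr0n add0r.
rewrite ltnS => kN; have {}IHN := IHN kN.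
rewrite root_sumS addrAC (vnormD_sq hdot) vnormZr // exprMn svalue_sq (vnormZJ hJ).
have -> : rdot dot (root_sum N v - root_sum k v)
    ((svalue N)%:C *: (dot v (e N) *: J (e N))) = 0.
  by rewrite /rdot !dotZr dotDl dotNl !root_sum_orth // subrr !mulr0.
move: IHN; have := spectral_resid_step N v; have := spectral_seq_mono sT kN.
have := sqr_ge0 (vnorm (dot v (e N) *: e N)); have := spectral_ge0 k.
move: (vnorm (dot v (e N) *: e N) ^+ 2) (vnorm (spectral_resid N.+1 v) ^+ 2)
  (vnorm (spectral_resid N v) ^+ 2).
move=> a b c lk a0 lNk abc IHN; nra.
Qed.

(** The rate is uniform over the unit ball: the partial sums are Cauchy in operator norm. *)
Lemma root_sum_cauchy v k N :
  (k <= N)%N -> vnorm (root_sum N v - root_sum k v) <= svalue k * vnorm v.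
Proof.
move=> kN; rewrite -(@ler_sqr _ (vnorm _)) ?nnegrE ?mulr_ge0 ?vnorm_ge0 //.
rewrite exprMn svalue_sq.
have : l k * vnorm (spectral_resid k v) ^+ 2 <= l k * vnorm v ^+ 2.
  by rewrite ler_wpM2l // ler_sqr ?nnegrE ?vnorm_ge0 // spectral_resid_le.
have : 0 <= l k * vnorm (spectral_resid N v) ^+ 2 by rewrite mulr_ge0 ?sqr_ge0.
have := root_sum_dist_sq v kN.
lra.
Qed.

(** * Passage to the limit operator *)

Lemma svalue_cvg0 K eps : 0 <= K -> 0 < eps -> exists k, svalue k * K < eps.
Proof.
move=> K0 eps0; have e1 : 0 < eps / (K + 1) by rewrite divr_gt0 //; lra.
have [|k lk] := spectral_seq_cvg0 hdot sT hT (_ : 0 < (eps / (K + 1)) ^+ 2).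
  by rewrite exprn_gt0.
exists k; have sk : svalue k < eps / (K + 1).
  by rewrite -ltr_sqr ?nnegrE ?(ltW e1) // svalue_sq.
have eK : eps / (K + 1) * (K + 1) = eps by rewrite divfK // gt_eqF //; lra.
nra.
Qed.

(** Errors of the form [svalue k * K] disappear in the limit; monotonicity moves a good index past
    [k0]. *)
Lemma svalue_rate_le0 k0 (x K : R) : 0 <= K ->
  (forall k, (k0 <= k)%N -> x <= svalue k * K) -> x <= 0.
Proof.
move=> K0 xs; rewrite leNgt; apply/negP => x0.
have [k sk] := svalue_cvg0 K0 x0.
have := xs _ (leq_maxl k0 k); rewrite leNgt => /negP; apply.
by apply: le_lt_trans sk; rewrite ler_wpM2r // svalue_mono // leq_maxr.
Qed.

Lemma svalue_rate_eq0 k0 (x : H) (K : R) : 0 <= K ->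
  (forall k, (k0 <= k)%N -> vnorm x <= svalue k * K) -> x = 0.
Proof.
move=> K0 /(svalue_rate_le0 K0) x0; apply: vnorm_eq0; apply/eqP.
by rewrite eq_le x0 vnorm_ge0.
Qed.

Lemma root_sumP N a u v : root_sum N (a *: u + v) = a *: root_sum N u + root_sum N v.
Proof.
elim: N => [|N IHN]; first by rewrite /root_sum !big_ord0 scaler0 addr0.
rewrite !root_sumS IHN dotDl dotZl scalerDl -scalerA !scalerDr addrACA.
by congr (_ + _ + _); rewrite !scalerA mulrA [a * _]mulrC -mulrA.
Qed.

Lemma root_sum_cvg v :
  exists Yv, forall k, vnorm (Yv - root_sum k v) <= svalue k * vnorm v.
Proof.
apply: (@cvg_of_rate _ _ (root_sum^~ v) (fun k => svalue k * vnorm v)) => [k N|eps].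
  exact: root_sum_cauchy.
by apply: svalue_cvg0; exact: vnorm_ge0.
Qed.

Lemma root_exists : exists Y : {linear H -> H},
  forall v k, vnorm (Y v - root_sum k v) <= svalue k * vnorm v.
Proof.
have [Y YP] := choice root_sum_cvg.
have Ylin : linear Y.
  move=> a u v; apply/eqP; rewrite -subr_eq0; apply/eqP.
  apply: (@svalue_rate_eq0 0 _
    (vnorm (a *: u + v) + complex.Re `|a| * vnorm u + vnorm v)).
    by rewrite !addr_ge0 ?mulr_ge0 ?vnorm_ge0 // -ler0c RRe_real ?normr_real.
  move=> k _.
  have -> : Y (a *: u + v) - (a *: Y u + Y v) =
    (Y (a *: u + v) - root_sum k (a *: u + v)) -
    (a *: (Y u - root_sum k u) + (Y v - root_sum k v)).
    rewrite root_sumP scalerBr addrACA.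
    by rewrite -[- (a *: root_sum k u) - _]opprD [in RHS]opprB addrA subrK.
  apply: le_trans (vnormD _ _) _; rewrite vnormN.
  apply: le_trans (lerD (YP _ k) (vnormD _ _)) _.
  have := YP v k; have := YP u k; rewrite vnormZ.
  have : 0 <= complex.Re `|a| by rewrite -ler0c RRe_real ?normr_real.
  have := svalue_ge0 k; have := vnorm_ge0 u.
  move: (vnorm (Y u - _)) (vnorm (Y v - _)) (complex.Re _) => x y c; nra.
by exists (HB.pack_for {linear H -> H} Y (GRing.isLinear.Build _ _ _ _ Y Ylin)).
Qed.

(** * Identities and bounds for the root *)

Section Properties.
Context (Y : {linear H -> H}).
Context (YP : forall v k, vnorm (Y v - root_sum k v) <= svalue k * vnorm v).

(** The partial sum vanishes at [w], so the approximation error alone bounds [Y w]. *)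
Lemma root_le_svalue k w : (forall j, (j < k)%N -> dot w (e j) = 0) ->
  vnorm (Y w) <= svalue k * vnorm w.
Proof.
move=> we; have := YP w k; suff -> : root_sum k w = 0 by rewrite subr0.
by rewrite /root_sum big1 // => i _; rewrite we ?scale0r ?scaler0.
Qed.

Lemma root_bounded v : vnorm (Y v) <= svalue 0%N * vnorm v.
Proof. by apply: root_le_svalue. Qed.

Lemma root_eigen i : Y (e i) = (svalue i)%:C *: J (e i).
Proof.
apply/eqP; rewrite -subr_eq0; apply/eqP.
(* The term of index [i] occurs in [root_sum k] only for [k > i], hence the start at [i.+1]. *)
apply: (@svalue_rate_eq0 i.+1 _ (vnorm (e i))) => [|k ik].
  exact: vnorm_ge0.
have := YP (e i) k; suff -> : root_sum k (e i) = (svalue i)%:C *: J (e i) by [].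
rewrite /root_sum (bigD1 (Ordinal ik)) //= big1 => [|j ji].
  rewrite addr0; congr (_ *: _); case: sT => _ _ /(_ i) [ei|[-> _]] _ _.
    by rewrite (dotvv hdot) ei expr1n scale1r.
  by rewrite (anticonj0 hJ) scaler0.
by rewrite spectral_orth ?scale0r ?scaler0 // eq_sym.
Qed.

Lemma root_Jeigen i : Y (J (e i)) = 0.
Proof.
apply: (@svalue_rate_eq0 0 _ (vnorm (J (e i)))) => [|k _]; first exact: vnorm_ge0.
by apply: root_le_svalue => j _; rewrite spectral_Jorth.
Qed.

(** The partial sums lie in the span of the [J (e i)], which [Y] kills; boundedness of [Y] takes
    care of the error. *)
Lemma root_sqr0 v : Y (Y v) = 0.
Proof.
apply: (@svalue_rate_eq0 0 _ (svalue 0%N * vnorm v)) => [|k _].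
  by rewrite mulr_ge0 ?vnorm_ge0.
have Ysum : Y (root_sum k v) = 0.
  by rewrite /root_sum linear_sum big1 // => i _; rewrite !linearZ /= root_Jeigen
    !scaler0.
have -> : Y (Y v) = Y (Y v - root_sum k v) by rewrite linearB /= Ysum subr0.
apply: (le_trans (root_bounded _)); rewrite mulrCA; apply: ler_wpM2l => //; exact: YP.
Qed.

Lemma root_adjoint u v : dot (Y u) v = dot u (J (Y (J v))).
Proof.
(* Term by term: the adjoint of [s <., e> J e] is [s <., J e> e], and composing the term with [J] on
   both sides gives the same operator. *)
have sum_adj N x : dot (root_sum N x) v = dot x (J (root_sum N (J v))).
  elim: N => [|N IHN]; first by rewrite /root_sum !big_ord0 (anticonj0 hJ) dot0l dot0r.
  rewrite !root_sumS (anticonjD hJ) dotDl dotDr IHN; congr (_ + _).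
  rewrite (anticonjZr hJ) (anticonjZ hJ) (anticonjK hJ) !dotZl dotZr_real dotZr_conj
    dotNr.
  by rewrite (dotJl hdot hJ (e N) v) !mulrN [dot x _ * _]mulrC.
(* One inequality for all [x] suffices: [a *: u] and its negative give equality, and varying [a]
   recovers the complex identity. *)
have le0 x : rdot dot (Y x) v - rdot dot x (J (Y (J v))) <= 0.
  apply: (@svalue_rate_le0 0 _ (2 * vnorm x * vnorm v)) => [|k _].
    by rewrite !mulr_ge0 ?vnorm_ge0.
  have -> : rdot dot (Y x) v - rdot dot x (J (Y (J v))) =
    rdot dot (Y x - root_sum k x) v + rdot dot x (- J (Y (J v) - root_sum k (J v))).
    rewrite (anticonjD hJ) (anticonjN hJ) !rdotE.
    have -> : rdot dot (root_sum k x) v = rdot dot x (J (root_sum k (J v)))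
      by rewrite /rdot sum_adj.
    by ring.
  apply: le_trans (lerD (rdot_le hdot _ _) (rdot_le hdot _ _)) _.
  rewrite vnormN (vnormJ hJ); have := YP (J v) k; rewrite (vnormJ hJ).
  have := YP x k; have := vnorm_ge0 v; have := vnorm_ge0 x.
  move: (vnorm (Y x - _)) (vnorm (Y (J v) - _)) => a b; nra.
apply: rdot_eq_dot => a; rewrite -linearZ /=.
have := le0 (a *: u); have := le0 (- (a *: u)); rewrite raddfN /= !rdotNl.
by move=> h1 h2; apply/eqP; rewrite eq_le; apply/andP; split; lra.
Qed.

(** As [J Y J] is the adjoint of [Y], this is [Y* Y - Y Y*] applied to [v]. *)
Definition root_commutator v := J (Y (J (Y v))) - Y (J (Y (J v))).

Lemma root_commutatorP a u v :
  root_commutator (a *: u + v) = a *: root_commutator u + root_commutator v.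
Proof.
rewrite /root_commutator linearP (anticonjD hJ) (anticonjZ hJ) linearP (anticonjD hJ)
  (anticonjZ_conj hJ).
rewrite (anticonjD hJ) (anticonjZ hJ) linearP (anticonjD hJ) (anticonjZ_conj hJ)
  linearP.
by rewrite scalerBr addrACA -opprD.
Qed.

(** Both sides agree on all [e i] and [J (e i)]. What remains is the residual, orthogonal to the
    first [k] pairs, where both sides are small. *)
Lemma root_commutatorE v : T v = root_commutator v.
Proof.
have Z0 : root_commutator 0 = 0.
  by rewrite /root_commutator raddf0 (anticonj0 hJ) raddf0 (anticonj0 hJ) raddf0 subrr.
have ZD u w : root_commutator (u + w) = root_commutator u + root_commutator w.
  by have := root_commutatorP 1 u w; rewrite !scale1r.
have ZZ a u : root_commutator (a *: u) = a *: root_commutator u.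
  by have := root_commutatorP a u 0; rewrite Z0 !addr0.
have Ze i : root_commutator (e i) = T (e i).
  by rewrite /root_commutator root_eigen root_Jeigen (anticonjZr hJ) (anticonjK hJ)
    (anticonj0 hJ) raddf0 subr0 linearZ raddfN /= root_eigen
     (anticonjZr hJ) (anticonjN hJ) (anticonjZr hJ) (anticonjK hJ) !scalerN opprK
       scalerA -rmorphM -expr2 svalue_sq spectral_eigen.
have ZJe i : root_commutator (J (e i)) = T (J (e i)).
  by rewrite /root_commutator root_Jeigen (anticonj0 hJ) raddf0 (anticonj0 hJ) sub0r
    (anticonjK hJ) raddfN /= root_eigen (anticonjN hJ) (anticonjZr hJ) (anticonjK hJ)
    !scalerN opprK linearZ /= root_eigen scalerA -rmorphM -expr2 svalue_sq TJ
      spectral_eigen (anticonjZr hJ).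
have Zproj k : root_commutator (spectral_proj k v) = T (spectral_proj k v).
  elim: k => [|k IHk]; first by rewrite /spectral_proj big_ord0 Z0 raddf0.
  by rewrite spectral_projS !ZD !ZZ IHk Ze ZJe !linearD !linearZ.
apply/eqP; rewrite -subr_eq0; apply/eqP.
(* The 3 counts [T r] and the two terms of [root_commutator r], each at most
   [svalue 0 * svalue k * |v|]. *)
apply: (@svalue_rate_eq0 0 _ (3 * svalue 0%N * vnorm v)) => [|k _].
  by rewrite !mulr_ge0 ?vnorm_ge0.
set r := spectral_resid k v.
have vE : v = spectral_proj k v + r by rewrite addrC subrK.
have -> : T v - root_commutator v = T r - root_commutator r.
  by rewrite {1 2}vE raddfD ZD /= Zproj opprD addrACA subrr add0r.
have r_orth j : (j < k)%N -> J_orthogonal dot J r (e j).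
  by move=> jk; exact: spectral_resid_orth.
have b1 : vnorm (T r) <= svalue k ^+ 2 * vnorm r.
  by rewrite svalue_sq; case: sT => _ _ _ _; apply.
have b2 : vnorm (Y r) <= svalue k * vnorm r.
  by apply: root_le_svalue => j /r_orth [].
have b3 : vnorm (Y (J r)) <= svalue k * vnorm r.
  rewrite -(vnormJ hJ r); apply: root_le_svalue => j.
  by move=> /r_orth /(J_orthogonalJ hdot hJ) [].
have b4 : vnorm (J (Y (J (Y r)))) <= svalue 0%N * vnorm (Y r).
  by rewrite (vnormJ hJ) -(vnormJ hJ (Y r)); exact: root_bounded.
have b5 : vnorm (Y (J (Y (J r)))) <= svalue 0%N * vnorm (Y (J r)).
  by rewrite -(vnormJ hJ (Y (J r))); exact: root_bounded.
apply: le_trans (vnormD _ _) _; rewrite vnormN.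
apply: le_trans (lerD b1 (vnormD _ _)) _; rewrite vnormN.
have c1 : svalue 0%N * vnorm (Y r) <= svalue 0%N * (svalue k * vnorm r).
  by rewrite ler_wpM2l.
have c2 : svalue 0%N * vnorm (Y (J r)) <= svalue 0%N * (svalue k * vnorm r).
  by rewrite ler_wpM2l.
have c3 : svalue k ^+ 2 * vnorm r <= svalue 0%N * (svalue k * vnorm r).
  by rewrite mulrA expr2 ler_wpM2r ?vnorm_ge0 // ler_wpM2r // svalue_mono.
have c4 : svalue 0%N * (svalue k * vnorm r) <= svalue 0%N * (svalue k * vnorm v).
  by do 2!apply: ler_wpM2l => //; exact: spectral_resid_le.
move: b4 b5 c1 c2 c3 c4; lra.
Qed.

Lemma root_dominated v : vnorm (Y v) ^+ 2 <= vnorm (T v) * vnorm v.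
Proof.
set A := fun v => J (Y (J v)).
have adj u w : rdot dot (Y u) w = rdot dot u (A w).
  by rewrite /rdot root_adjoint.
have AYT : vnorm (A (Y v)) <= vnorm (T v).
  rewrite -(@ler_sqr _ (vnorm _)) ?nnegrE ?vnorm_ge0 //.
  rewrite root_commutatorE /root_commutator -/(A _) (vnormB_sq hdot).
  (* Moving [A] to the other side gives [<Y Y A v, Y v>], which vanishes because [Y Y = 0]. *)
  have -> : rdot dot (A (Y v)) (Y (J (Y (J v)))) = 0.
    by rewrite rdotC -/(A v) -adj root_sqr0 /rdot dot0l.
  by have := sqr_ge0 (vnorm (Y (J (Y (J v))))); lra.
rewrite -(rdotvv hdot) adj rdotC; apply: le_trans (rdot_le hdot _ _) _.
by rewrite ler_wpM2r ?vnorm_ge0.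
Qed.

End Properties.
End Root.

(* A [T]-net of the unit ball is also a [Y]-net. *)
Lemma compact_operator_dominated (R : realType) (H : completeNormedModType R[i])
    (T Y : {linear H -> H}) :
  (forall v, vnorm (Y v) ^+ 2 <= vnorm (T v) * vnorm v) ->
  compact_operator T -> compact_operator Y.
Proof.
move=> YT hT; apply: totally_bounded_precompact => eps eps0.
(* This will give [|T w - T v| <= eps^2 / 4]; with [|w - v| <= 2] it follows that
   [|Y w - Y v|^2 <= eps^2 / 2]. *)
have d0 : 0 < eps ^+ 2 / 8 by rewrite divr_gt0 // exprn_gt0.
have [t tP] := precompact_totally_bounded hT d0.
pose D p := [set v : H | vnorm v <= 1 /\ vnorm (p - T v) < eps ^+ 2 / 8].
(* Points of the [T]-net need not be images of the unit ball, so each is replaced by a vector of the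
   ball whose image is close. The default 0 arises only for a net point close to no image. *)
exists [seq Y (xget 0 (D p)) | p <- t] => _ [v /= v1 <-].
have [|p pt pv] := tP (T v); first by exists v.
exists (Y (xget 0 (D p))); first exact: map_f.
have Dv : D p v by split => //; rewrite -vnorm_le1.
have [w1 pw] := xgetPex 0 (ex_intro _ _ Dv).
set w := xget 0 (D p) in w1 pw *.
rewrite -ltr_sqr ?nnegrE ?vnorm_ge0 ?(ltW eps0) // -linearB /=.
apply: le_lt_trans (YT _) _; rewrite linearB /=.
have h1 : vnorm (T w - T v) <= eps ^+ 2 / 4.
  by have := vnorm_triangle p (T w) (T v); rewrite (vnormB (T w) p); lra.
have h2 : vnorm (w - v) <= 2.
  have := vnormD w (- v); rewrite vnormN; case: Dv; lra.
apply: le_lt_trans (ler_pM (vnorm_ge0 _) (vnorm_ge0 _) h1 h2) _; lra.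
Qed.

Theorem theorem4p12 (R : realType) (H : completeNormedModType R[i])
    (dot : {dot H for (@conjc R)}) (hdot : induces_norm dot)
    (hsep : separable H) (hdim : infinite_dimensional H)
    (J : H -> H) (hJ : anti_conjugation J)
    (T : {linear H -> H}) (hT : sp_infty dot J T)
    (hTsa : T =1 adjoint dot T) :
  exists2 Y : {linear H -> H},
    sp_infty dot J Y & T =1 commutator (adjoint dot Y) Y.
Proof.
have [cT skewT] := hT.
(* The symmetry of [T] is evaluated at [J v], and the adjoint is replaced by [T]. *)
have TJ v : T (J v) = - J (T v).
  by rewrite skewT (pinvJ hJ) (anticonjK hJ) opprK -hTsa.
have [l [e sT]] := spectral_seq_exists hdot hJ cT (selfadjoint_dot hdot hTsa) TJ.
have [Y YP] := root_exists hdot hJ cT sT.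
have adjY v : adjoint dot Y v = J (Y (J v)).
  by apply: (adjoint_unique hdot) => u; exact: (root_adjoint hdot hJ cT sT YP).
exists Y; last first.
  by move=> v; rewrite /commutator !adjY; exact: (root_commutatorE hdot hJ cT TJ sT YP).
split; first exact: compact_operator_dominated (root_dominated hdot hJ cT TJ sT YP) cT.
by move=> v; rewrite adjY (pinvJ hJ) !(anticonjN hJ, anticonjK hJ, opprK).
Qed.
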